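(* Let $(X_n)$ be a sequence of finite sets and let $(\mathcal{F}_n)$ be a sequence of nontrivial upper sets $\mathcal{F}_n \subseteq 2^{X_n}$. Let $K>0$ be a constant such that $p_c(\mathcal{F}_n)\leq K q(\mathcal{F}_n)\log \ell(\mathcal{F}_n)$ for all $n$. If $\ell(\mathcal{F}_n)\to\infty$ and the Kahn-Kalai bounds provide nontrivial information for $(\mathcal{F}_n)$, then $\frac{1}{q(\mathcal{F}_n)}\to\infty$ and $\dim(\mathcal{F}_n)\to\infty$.
   Context: For a finite set $X$, an upper set is a subset $\mathcal{F}\subseteq 2^X$ such that $A\in\mathcal{F}$ and $A\subseteq B\subseteq X$ imply $B\in\mathcal{F}$; it is nontrivial if $\mathcal{F}\neq\emptyset$ and $\mathcal{F}\neq 2^X$. For $p\in[0,1]$ let $\mu_p(\mathcal{F})=\sum_{S\in\mathcal{F}}p^{|S|}(1-p)^{|X|-|S|}$; for nontrivial $\mathcal{F}$, the critical probability $p_c(\mathcal{F})$ is the unique $p\in[0,1]$ with $\mu_p(\mathcal{F})=\frac12$. For $S\subseteq X$ let $\langle S\rangle=\{T\subseteq X: S\subseteq T\}$, and for $\mathcal{G}\subseteq 2^X$ let $\langle\mathcal{G}\rangle=\bigcup_{S\in\mathcal{G}}\langle S\rangle$. A set $\mathcal{G}\subseteq 2^X$ is a cover of $\mathcal{F}$ if $\mathcal{F}\subseteq\langle\mathcal{G}\rangle$. $\mathcal{F}$ is $p$-small if it has a cover $\mathcal{G}$ with $\sum_{S\in\mathcal{G}}p^{|S|}\leq\frac12$.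 The expectation threshold $q(\mathcal{F})$ is the largest $p\in[0,1]$ for which $\mathcal{F}$ is $p$-small. The covering dimension is $\dim(\mathcal{F})=\min\{|\mathcal{G}|:\mathcal{G}\subseteq2^X,\ \mathcal{F}\subseteq\langle\mathcal{G}\rangle\neq2^X\}$. $\mathcal{F}_0$ denotes the set of (inclusion-)minimal elements of $\mathcal{F}$, $\ell_0(\mathcal{F})=\max\{|S|:S\in\mathcal{F}_0\}$ and $\ell(\mathcal{F})=\max\{\ell_0(\mathcal{F}),2\}$. $\log$ is the logarithm to base 2. The Kahn-Kalai bounds provide nontrivial information for $(\mathcal{F}_n)$ if there exists $N$ such that $Kq(\mathcal{F}_n)\log\ell(\mathcal{F}_n)<1$ for all $n\geq N$. *)

(* Defs.v *)
From mathcomp Require Export all_boot all_order all_algebra.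
From mathcomp Require Export all_classical all_reals all_analysis.
Export Order.TTheory GRing.Theory Num.Theory.
Export numFieldNormedType.Exports.

Set Implicit Arguments.
Unset Strict Implicit.
Unset Printing Implicit Defensive.

Local Open Scope classical_set_scope.
Local Open Scope ring_scope.

(* A finite set X is a finType, 2^X is {set X}, and a family of subsets of X
   is an element of {set {set X}}. *)

Definition upper_set (X : finType) (F : {set {set X}}) : Prop :=
  forall A B : {set X}, A \in F -> A \subset B -> B \in F.

Definition nontrivial (X : finType) (F : {set {set X}}) : Prop :=
  F <> finset.set0 /\ F <> [set: {set X}]%SET.

Definition mu (R : realType) (X : finType) (p : R) (F : {set {set X}}) : R :=
  \sum_(S in F) p ^+ #|S| * (1 - p) ^+ (#|X| - #|S|).

(* The default value 0 of xget is irrelevant when F is a nontrivial upper set: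
   then p |-> mu p F is continuous and strictly increasing from 0 to 1 on
   [0, 1], so exactly one p qualifies. *)
Definition critical_probability (R : realType) (X : finType)
    (F : {set {set X}}) : R :=
  xget 0 [set p : R | 0 <= p <= 1 /\ mu p F = 1 / 2].

Definition generated (X : finType) (G : {set {set X}}) : {set {set X}} :=
  (\bigcup_(S in G) [set T : {set X} | S \subset T])%SET.

Definition cover_of (X : finType) (F G : {set {set X}}) : bool :=
  F \subset generated G.

Definition p_small (R : realType) (X : finType) (p : R)
    (F : {set {set X}}) : Prop :=
  exists G : {set {set X}}, cover_of F G /\ \sum_(S in G) p ^+ #|S| <= 1 / 2.

(* The largest element of a set of reals.  The default value 0 of xget is
   irrelevant when F does not contain the empty set: F is then 0-small (it
   covers itself, and 0 ^+ k = 0 for k > 0), and the set of p in [0, 1] for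
   which F is p-small is a finite union of closed sets. *)
Definition expectation_threshold (R : realType) (X : finType)
    (F : {set {set X}}) : R :=
  let small := [set p : R | 0 <= p <= 1 /\ p_small p F] in
  xget 0 (small `&` ubound small).

(* The base point F of the arg min satisfies the condition whenever F is an
   upper set other than 2^X, because then generated F = F. *)
Definition covering_dim (X : finType) (F : {set {set X}}) : nat :=
  #|[arg min_(G < F | cover_of F G && (generated G != [set: {set X}]%SET)) #|G|]|.

Definition minimal_elements (X : finType) (F : {set {set X}}) :
    {set {set X}} :=
  [set S : {set X} | minset (fun A : {set X} => A \in F) S]%SET.

Definition ell0 (X : finType) (F : {set {set X}}) : nat :=
  (\max_(S in minimal_elements F) #|S|)%N.

Definition ell (X : finType) (F : {set {set X}}) : nat := maxn (ell0 F) 2.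

Definition log2 (R : realType) (x : R) : R := ln x / ln 2.

Definition kahn_kalai_nontrivial_information (R : realType) (K : R)
    (X : nat -> finType) (F : forall n, {set {set X n}}) : Prop :=
  exists N : nat, forall n : nat, (N <= n)%N ->
    K * expectation_threshold R (F n) * log2 (ell (F n))%:R < 1.

(* Main.v *)
Require Import Defs.
From mathcomp Require Import all_boot all_order all_algebra.
From mathcomp Require Import all_classical all_reals all_analysis.

(* Once [q] is known to be positive, the nontriviality condition
   [K q log ell < 1] reads [1/q > K log ell], whence [1/q] tends to infinity.
   For the dimension, a cover [G] realising [dim F] consists of nonempty sets,
   so at [p = 1 / (2 (dim F + 1))] its cost is at most [(dim F) p <= 1/2].
   Hence [q >= 1 / (2 (dim F + 1))], which both gives [q > 0] and forces
   [dim F] to infinity along with [1/q]. *)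

Local Open Scope classical_set_scope.
Local Open Scope ring_scope.

(** For a fixed cover the cost is a polynomial in [p], so bounding it by 1/2 is a closed condition;
    a finite [X] admits only finitely many covers, and a finite union of closed sets is closed. *)
Lemma closed_p_small (R : realType) (X : finType) (F : {set {set X}}) :
  closed [set p : R | 0 <= p <= 1 /\ p_small p F].
Proof.
pose cost (G : {set {set X}}) : {poly R} := \sum_(S in G) 'X^#|S|.
have -> : [set p : R | 0 <= p <= 1 /\ p_small p F] =
    ([set p : R | 0 <= p] `&` [set p : R | p <= 1]) `&`
    \bigcup_(G in [set G | cover_of F G])
      (horner (cost G) @^-1` [set y : R | y <= 1 / 2]).
  apply/seteqP; split=> p /=.
    move=> [/andP[p0 p1] [G [FG Gp]]]; split=> //; exists G => //=.
    by rewrite /cost horner_sum; under eq_bigr do rewrite hornerXn.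
  move=> [[p0 p1] [G /= FG Gp]]; split; first by rewrite p0 p1.
  exists G; split=> //; move: Gp; rewrite /cost horner_sum.
  by under eq_bigr do rewrite hornerXn.
apply: closedI; first by apply: closedI; [exact: closed_ge|exact: closed_le].
apply: closed_bigcup => [|G _]; first exact: finite_finset.
by apply: closed_comp => [x _|]; [exact: continuous_horner|exact: closed_le].
Qed.

Lemma p_small_le_expectation_threshold (R : realType) (X : finType)
    (F : {set {set X}}) (p : R) :
  0 <= p <= 1 -> p_small p F -> p <= expectation_threshold R F.
Proof.
move=> p01 pF; rewrite /expectation_threshold.
set A := [set p : R | _].
have Ap : A p by [].
have ubA : has_ubound A by exists 1 => x [/andP[]].
(* The supremum of the closed set [A] belongs to [A], so a maximum exists and [xget] does not fall
   back on its default 0. *)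
have : exists x, (A `&` ubound A) x.
  exists (sup A); split; last by move=> x Ax; exact: ub_le_sup.
  by apply: closed_p_small; apply: closure_sup => //; exists p.
by move/(xgetPex (0 : R)) => [_]; exact.
Qed.

Lemma generated_upper_set (X : finType) (F : {set {set X}}) :
  upper_set F -> generated F = F.
Proof.
move=> F_upper; apply/setP => A; apply/bigcupP/idP => [[S SF]|AF].
  by rewrite inE; exact: F_upper.
by exists A; rewrite ?inE.
Qed.

Lemma covering_dimP (X : finType) (F : {set {set X}}) :
  upper_set F -> nontrivial F ->
  exists G : {set {set X}}, [/\ cover_of F G,
    generated G != [set: {set X}]%SET & #|G| = covering_dim F].
Proof.
move=> F_upper [_ /eqP FT]; rewrite /covering_dim.
case: arg_minnP => [|G /andP[FG GT] _]; last by exists G.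
by rewrite /cover_of generated_upper_set // subxx.
Qed.

Lemma generated_set0 (X : finType) (G : {set {set X}}) :
  finset.set0 \in G -> generated G = [set: {set X}]%SET.
Proof.
move=> G0; apply/setP => A; rewrite finset.in_setT; apply/bigcupP.
by exists finset.set0; rewrite // inE finset.sub0set.
Qed.

Lemma expectation_threshold_ge_dim (R : realType) (X : finType)
    (F : {set {set X}}) :
  upper_set F -> nontrivial F ->
  ((covering_dim F).+1.*2%:R)^-1 <= expectation_threshold R F.
Proof.
move=> F_upper F_nontrivial.
have [G [FG GT <-]] := covering_dimP _ _ F_upper F_nontrivial.
(* The successor in the denominator keeps it positive without a separate check that [G] is
   nonempty. *)
set p : R := _^-1.
have p0 : 0 <= p by rewrite invr_ge0.
have p1 : p <= 1 by rewrite invf_le1 ?ltr0n ?ler1n ?double_gt0.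
apply: p_small_le_expectation_threshold; first by rewrite p0.
exists G; split=> //; apply: (@le_trans _ _ (\sum_(S in G) p)).
  (* Since [p] is at most 1, [p ^+ #|S|] is at most [p] as soon as [S] is nonempty; an empty [S]
     would make [G] generate all of the power set. *)
  apply: ler_sum => S SG; rewrite -[leRHS]expr1; apply: ler_wiXn2l => //.
  rewrite card_gt0; apply/eqP => S0; move/eqP: GT; apply.
  by apply: generated_set0; rewrite -S0.
rewrite sumr_const ler_pdivlMr // -(mulr_natl p) mulrAC -natrM muln2.
by rewrite ler_pdivrMr ?ltr0n ?double_gt0 // mul1r ler_nat leq_double.
Qed.

Lemma cvgr_log2 (R : realType) (u : nat -> nat) :
  u @ \oo --> \oo -> (fun n => log2 (u n)%:R : R) @ \oo --> +oo.
Proof.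
move=> /cvgnyPge u_oo; apply/cvgryPge => A.
have ln2 : 0 < ln 2 :> R by rewrite ln_gt0 ?ltr1n.
(* The threshold is an integer above 2 to the power [A], written with [expR]. *)
apply: filterS (u_oo (Num.bound (expR (A * ln 2)))) => n un.
have le_exp : expR (A * ln 2) <= (u n)%:R.
  apply/ltW/(lt_le_trans (archi_boundP (expR_ge0 _))); by rewrite ler_nat.
rewrite /log2 ler_pdivlMr // -ler_expR lnK // posrE.
exact: lt_le_trans (expR_gt0 _) le_exp.
Qed.

Theorem mainTheorem3 (R : realType) (X : nat -> finType)
    (F : forall n : nat, {set {set X n}})
    (F_upper : forall n : nat, upper_set (F n))
    (F_nontrivial : forall n : nat, nontrivial (F n))
    (K : R) (K_gt0 : 0 < K)
    (K_bound : forall n : nat,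
      critical_probability R (F n)
        <= K * expectation_threshold R (F n) * log2 (ell (F n))%:R)
    (ell_infty : (fun n : nat => ell (F n)) @ \oo --> \oo)
    (KK_info : kahn_kalai_nontrivial_information K F) :
  (fun n : nat => 1 / expectation_threshold R (F n)) @ \oo --> +oo
  /\ (fun n : nat => covering_dim (F n)) @ \oo --> \oo.
Proof.
have q_ge n := expectation_threshold_ge_dim R _ _ (F_upper n) (F_nontrivial n).
have q_gt0 n : 0 < expectation_threshold R (F n).
  by apply: lt_le_trans (q_ge n); rewrite invr_gt0 ltr0n double_gt0.
have invq_oo : (fun n : nat => 1 / expectation_threshold R (F n)) @ \oo --> +oo.
  apply/cvgryPge => A; have [N KK] := KK_info.
  have /cvgryPge/(_ (A / K)) log_oo := cvgr_log2 R _ ell_infty.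
  near=> n.
  have logn : A / K <= log2 (ell (F n))%:R by near: n.
  have KKn : K * expectation_threshold R (F n) * log2 (ell (F n))%:R < 1.
    by apply: KK; near: n; exact: nbhs_infty_ge.
  (* With [q] the expectation threshold, it remains to bound [A * q] by [K * q * log2 ell];
     cancelling [q > 0] leaves [logn]. *)
  rewrite ler_pdivlMr //; apply: le_trans (ltW KKn).
  by rewrite mulrAC ler_pM2r // mulrC -ler_pdivrMr //.
split=> //; apply/cvgnyPge => A.
(* The bound 2(A+1) is chosen to match [q_ge]: from 2(A+1) <= 1/q <= 2(dim+1) follows A <= dim. *)
move/cvgryPge: invq_oo => /(_ A.+1.*2%:R); apply: filterS => n.
rewrite div1r => Aq; have := le_trans Aq (_ : _ <= (covering_dim (F n)).+1.*2%:R).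
rewrite ler_nat leq_double ltnS; apply.
by rewrite -lef_pV2 ?invrK ?posrE ?invr_gt0 ?ltr0n ?double_gt0.
Unshelve. all: by end_near.
Qed.
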